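(* Let $s\in\mathbb{C}$ and $\ell\in\mathbb{R}\setminus\{0\}$. Then for any $\beta\in\mathbb{C}$ with $\beta\neq \ell+ik\pi$ for all nonzero integers $k$, $$\operatorname{sinch}(s-\ell)=\operatorname{sinch}(\beta)\prod_{k=1}^\infty\left[1+\frac{(s-\ell)^2-(\beta-\ell)^2}{k^2\pi^2+(\beta-\ell)^2}\right].$$
   Context: The function $\operatorname{sinch}$ is the entire function $\operatorname{sinch}(s)=\sum_{m=0}^\infty \frac{s^{2m}}{(2m+1)!}$, and $i=\sqrt{-1}$.
   Formalization: The prefactor sinch(β) is corrected to sinch(β−ℓ); as printed the identity fails, e.g. at s=β=ℓ=1, where the left side is 1 and the right side is sinch(1)>1. *)

(* Defs.v *)
From mathcomp Require Export all_boot all_order all_algebra complex.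
From mathcomp Require Export all_classical all_reals all_analysis.
Export Order.TTheory GRing.Theory Num.Theory.
Export numFieldNormedType.Exports.

Set Implicit Arguments.
Unset Strict Implicit.
Unset Printing Implicit Defensive.

Local Open Scope classical_set_scope.
Local Open Scope ring_scope.

(* [R[i]] carries no topology of its own.  Viewed as a [numClosedFieldType] it
   inherits the one of its modulus, i.e. the usual topology of the plane. *)
Definition Cplx (R : realType) : numClosedFieldType := R[i]%C.

Definition ofR (R : realType) (x : R) : Cplx R := (x%:C)%C.

(* The series converges at every [s], so [limn] is its sum there and never
   the default value. *)
Definition sinch (R : realType) (s : Cplx R) : Cplx R :=
  limn (series (fun m : nat => s ^+ (2 * m) / ((2 * m).+1)`!%:R)).

(* The infinite product of the [a k] over [k >= 1] converges, as a sequence of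
   partial products, to [p]; [p = 0] is allowed. *)
Definition is_infprod (R : realType) (a : nat -> Cplx R) (p : Cplx R) : Prop :=
  (fun n : nat => \prod_(1 <= k < n.+1) a k) @ \oo --> p.

(* Main.v *)
(* For n = 2N+1 the polynomial sinch_poly N, whose value at z^2 is
   ((1 + z/n)^n - (1 - z/n)^n) / (2z), has constant term 1 and roots
   -(n tan(k pi/n))^2 for 1 <= k <= N (de Moivre), so at z^2 it equals
   \prod_(1 <= k <= N) (1 + z^2 / (n tan(k pi/n))^2).  Its coefficients differ
   from those of sinch by O(1/n) in a summable way, and since
   0 <= 1/x^2 - 1/tan^2 x <= 1 on ]0, pi/2[ each factor differs from
   1 + z^2/(k pi)^2 by O(1/n^2).  Letting N tend to infinity gives the Euler
   product of sinch.  That product does not vanish unless a factor does,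
   because |\prod (1 + a_k)| >= 1 - \sum |a_k| bounds its tails below; the
   statement is then the quotient of the products at s - l and beta - l. *)
From HB Require Import structures.
Require Import Defs.
From mathcomp Require Import ring lra zify.

Local Open Scope classical_set_scope.
Local Open Scope ring_scope.

(** * Inequalities for finite products and factorials *)

(** Induction on the splitting [(1 + a) A - (1 + b) B = (1 + a) (A - B) + (a - b) B], where the
    common majorant [c] controls both [1 + a] and [B]. *)
Lemma dist_prod1D (K : numFieldType) (I : eqType) (r : seq I) (a b c : I -> K) :
  {in r, forall k, `|a k| <= c k} -> {in r, forall k, `|b k| <= c k} ->
  `|\prod_(k <- r) (1 + a k) - \prod_(k <- r) (1 + b k)|
    <= \prod_(k <- r) (1 + c k) * \sum_(k <- r) `|a k - b k|.
Proof.
elim: r => [|k r IH] ac bc; first by rewrite !big_nil subrr normr0 mulr0.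
have /andP[ak bk] : (`|a k| <= c k) && (`|b k| <= c k).
  by rewrite ac ?bc// mem_head.
have {}ac : {in r, forall i, `|a i| <= c i}.
  by move=> i ir; apply: ac; rewrite in_cons ir orbT.
have {}bc : {in r, forall i, `|b i| <= c i}.
  by move=> i ir; apply: bc; rewrite in_cons ir orbT.
have {}IH := IH ac bc; rewrite !big_cons; set A := \prod_(_ <- _) _; set B := \prod_(_ <- _) _.
set C := \prod_(_ <- _) _; set S := \sum_(_ <- _) _.
have c0 : 0 <= c k by apply: le_trans ak.
have BC : `|B| <= C.
  rewrite /B /C normr_prod big_seq [leRHS]big_seq; apply: ler_prod => i ir.
  rewrite normr_ge0 /=.
  by rewrite (le_trans (ler_normD _ _))// normr1 lerD2l bc.
have C0 : 0 <= C by apply: le_trans BC.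
have -> : (1 + a k) * A - (1 + b k) * B = (1 + a k) * (A - B) + (a k - b k) * B.
  by ring.
rewrite (le_trans (ler_normD _ _))// !normrM mulrDr addrC; apply: lerD.
  rewrite mulrC ler_pM// (le_trans BC)// ler_peMl// lerDl//.
rewrite -mulrA ler_pM// (le_trans (ler_normD _ _))// normr1 lerD2l//.
Qed.

(** The inductive step is [(1 - x) (1 - S) >= 1 - (x + S)]; the hypothesis keeps both factors on the
    left nonnegative. *)
Lemma prod1D_ge (K : numFieldType) (I : Type) (r : seq I) (a : I -> K) :
  \sum_(k <- r) `|a k| <= 1 ->
  1 - \sum_(k <- r) `|a k| <= `|\prod_(k <- r) (1 + a k)|.
Proof.
elim: r => [|k r IH]; first by rewrite !big_nil normr1 subr0.
rewrite !big_cons; set S := \sum_(_ <- _) _ => h.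
have S0 : 0 <= S by apply: sumr_ge0.
have S1 : S <= 1 by apply: le_trans h; rewrite lerDr.
have k1 : `|a k| <= 1 by apply: le_trans h; rewrite lerDl.
rewrite normrM; apply: (@le_trans _ _ ((1 - `|a k|) * (1 - S))).
  rewrite -subr_ge0.
  have -> : (1 - `|a k|) * (1 - S) - (1 - (`|a k| + S)) = `|a k| * S by ring.
  exact: mulr_ge0.
apply: ler_pM; rewrite ?subr_ge0//; last exact: IH.
rewrite lerBlDr -(normrN (a k)) -{1}(normr1 K).
by rewrite -{1}(addrK (a k) 1) ler_normD.
Qed.

Lemma prod1D_le_expR (R : realType) (I : Type) (r : seq I) (a : I -> R) :
  (forall k, 0 <= a k) ->
  \prod_(k <- r) (1 + a k) <= expR (\sum_(k <- r) a k).
Proof.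
move=> a0; elim: r => [|k r IH]; first by rewrite !big_nil expR0.
rewrite !big_cons expRD ler_pM ?expR_ge1Dx ?addr_ge0//.
by apply: prodr_ge0 => i _; rewrite addr_ge0.
Qed.

(** Dividing by [n ^ j.+1] gives the product of the [1 - i/n], [i < j], bounded below by 1 minus the
    sum of the [i/n]; this form stays within [nat]. *)
Lemma expn_le_ffact (n j : nat) :
  (n ^ j.+1 <= n * n ^_ j + 'C(j, 2) * n ^ j)%N.
Proof.
elim: j => [|j IH]; first by rewrite ffactn0 expn0 expn1 muln1 leq_addr.
have le j' : (n ^_ j' <= n ^ j')%N.
  elim: j' => // i IHi; rewrite ffactnSr expnS mulnC leq_mul ?leq_subr//.
rewrite binS bin1 ffactnSr expnS (leq_trans (leq_mul (leqnn n) IH))//.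
have fE := leq_mul (leq_mul (leqnn n) (leqnn j)) (le j).
have -> : (n * (n ^_ j * (n - j)) = n * (n * n ^_ j) - n * j * n ^_ j)%N.
  by rewrite mulnCA mulnBr mulnBr; congr (_ - _)%N; ring.
rewrite expnS mulnDr mulnDl; set x := (n * j * _)%N in fE *.
have -> : (j * (n * n ^ j) = n * j * n ^ j)%N by ring.
have -> : ('C(j, 2) * (n * n ^ j) = n * ('C(j, 2) * n ^ j))%N by ring.
lia.
Qed.

Lemma fact_dbl_ge (m : nat) : (m * m`! <= (m.*2)`!)%N.
Proof.
elim: m => // m IH; rewrite doubleS !factS.
case: m IH => // m IH.
have h1 : (m.+1`! <= m.+1.*2`!)%N by apply: leq_trans IH; rewrite leq_pmull.
nia.
Qed.

(** * Odd part of a binomial power; factorisation over roots *)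

Lemma sum_split_parity (V : nmodType) (f : nat -> V) (n : nat) :
  \sum_(i < n.*2) f i = \sum_(m < n) f m.*2 + \sum_(m < n) f m.*2.+1.
Proof.
elim: n => [|n IH]; first by rewrite !big_ord0 addr0.
by rewrite doubleS !big_ord_recr/= IH [RHS]addrACA addrA.
Qed.

Lemma odd_part_binomial (K : comNzRingType) (x : K) (N : nat) :
  (1 + x) ^+ N.*2.+1 - (1 - x) ^+ N.*2.+1 =
  x * (\sum_(m < N.+1) 'C(N.*2.+1, m.*2.+1)%:R * (x ^+ 2) ^+ m) *+ 2.
Proof.
have E (y : K) : (1 + y) ^+ N.*2.+1 =
    \sum_(m < N.+1) 'C(N.*2.+1, m.*2)%:R * (y ^+ 2) ^+ m
    + y * \sum_(m < N.+1) 'C(N.*2.+1, m.*2.+1)%:R * (y ^+ 2) ^+ m.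
  rewrite exprDn.
  under eq_bigr do rewrite expr1n mul1r.
  rewrite -doubleS (sum_split_parity _ (fun i => y ^+ i *+ 'C(N.*2.+1, i))).
  congr (_ + _); last rewrite mulr_sumr; apply: eq_bigr => m _.
    by rewrite -exprM mul2n mulr_natl.
  by rewrite -exprM mul2n mulrCA -exprS mulr_natl.
rewrite (E x) (E (- x)) sqrrN; ring.
Qed.

(** Dividing the factorisation at [y] by the one at 0 cancels the leading coefficient; [p.[0] = 1]
    also keeps 0 from being a root. *)
Lemma poly_prod_roots (K : fieldType) (p : {poly K}) (rs : seq K) (y : K) :
  size p = (size rs).+1 -> p.[0] = 1 -> all (root p) rs -> uniq rs ->
  p.[y] = \prod_(r <- rs) (1 - y / r).
Proof.
move=> sp p0 rp urs.
have pE := all_roots_prod_XsubC sp rp; rewrite uniq_rootsE in pE.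
have {pE} pE x : p.[x] = lead_coef p * \prod_(r <- rs) (x - r).
  rewrite {1}(pE urs) hornerZ horner_prod; congr (_ * _).
  by apply: eq_bigr => i _; rewrite !hornerE.
have rn0 r : r \in rs -> r != 0.
  move=> /(allP rp); apply: contraTneq => ->.
  by rewrite /root p0 oner_eq0.
rewrite -[LHS]mulr1 -[X in _ * X = _]invr1 -[X in _ / X]p0 !pE invfM.
have lp : lead_coef p != 0 by rewrite lead_coef_eq0 -size_poly_eq0 sp.
rewrite mulrACA divff// mul1r -prodfV -big_split/= [LHS]big_seq [RHS]big_seq.
apply: eq_bigr => r /rn0 r0; rewrite sub0r; field.
by rewrite oppr_eq0 r0.
Qed.

(** * Trigonometric bounds and sums of inverse squares *)

Lemma sin_le (R : realType) (x : R) : 0 <= x -> sin x <= x.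
Proof.
rewrite le_eqVlt => /predU1P[<-|x0]; first by rewrite sin0.
have [|c _] := @MVT R sin cos 0 x x0 (fun y _ => is_derive_sin y).
  by apply: continuous_subspaceT => y; exact: continuous_sin.
by rewrite sin0 !subr0 => ->; rewrite ler_piMl ?cos_le1// ltW.
Qed.

Lemma tan_ge (R : realType) (x : R) : 0 <= x < pi / 2 -> x <= tan x.
Proof.
rewrite le_eqVlt => /andP[/predU1P[<-|x0] xp]; first by rewrite tan0.
have cos0 y : 0 <= y <= x -> 0 < cos y.
  by move=> /andP[y0 yx]; apply: cos_gt0_pihalf; have := pi_gt0 R; lra.
have [||c] := @MVT R tan (fun y => (cos y) ^- 2) 0 x x0.
- move=> y; rewrite in_itv/= => /andP[y0 yx]; apply: is_derive_tan.
  by rewrite gt_eqF// cos0// !ltW.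
- apply: derivable_within_continuous => y; rewrite in_itv/= => yx.
  by apply: derivable_tan; rewrite gt_eqF// cos0.
rewrite in_itv/= tan0 !subr0 => /andP[c0 cx] ->.
have cc : 0 < cos c by rewrite cos0// !ltW.
rewrite ler_peMl ?(ltW x0)// invf_ge1 ?exprn_gt0//.
Qed.

(** The lower bound is [x <= tan x]. The upper one is [sin x <= x], through
    [1/tan^2 = 1/sin^2 - 1]. *)
Lemma inv_tan_sqr (R : realType) (x : R) : 0 < x < pi / 2 ->
  0 <= (x ^+ 2)^-1 - (tan x ^+ 2)^-1 <= 1.
Proof.
move=> /andP[x0 xp]; have tx : x <= tan x by apply: tan_ge; rewrite ltW.
have s0 : 0 < sin x by rewrite sin_gt0_pihalf// x0.
have c0 : 0 < cos x by apply: cos_gt0_pihalf; have := pi_gt0 R; lra.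
apply/andP; split.
  rewrite subr_ge0 lef_pV2 ?posrE ?exprn_gt0 ?(lt_le_trans x0)//.
  by rewrite ler_sqr ?nnegrE// ltW// (lt_le_trans x0).
have -> : (tan x ^+ 2)^-1 = (sin x ^+ 2)^-1 - 1.
  rewrite /tan expr_div_n invf_div cos2sin2 mulrBl mul1r divff//.
  by rewrite gt_eqF// exprn_gt0.
rewrite opprB addrA lerBlDr addrC lerD2l lef_pV2 ?posrE ?exprn_gt0//.
by rewrite ler_sqr ?nnegrE ?sin_le ?ltW.
Qed.

(** Telescoping: [1/(n+1)^2 <= 1/n - 1/(n+1)], with defect [1/(n (n+1)^2)]. *)
Lemma sum_inv_sqr_le (R : realType) (m n : nat) :  (0 < m)%N -> (m <= n)%N ->
  \sum_(m.+1 <= k < n.+1) ((k%:R : R) ^+ 2)^-1 <= m%:R^-1 - n%:R^-1.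
Proof.
move=> m0; elim: n => [|n IH]; first by rewrite leqNgt m0.
rewrite leq_eqVlt => /predU1P[<-|mn]; first by rewrite big_geq// subrr.
rewrite big_nat_recr//= (le_trans (lerD (IH _) (lexx _)))//.
have n0 : 0 < n%:R :> R by rewrite ltr0n (leq_trans m0).
rewrite -natr1 -addrA lerD2l.
rewrite -subr_ge0; set y := n%:R in n0 *.
have -> : - (y + 1)^-1 - (- y^-1 + ((y + 1) ^+ 2)^-1) = (y * (y + 1) ^+ 2)^-1.
  by field; rewrite !gt_eqF// ltr_wpDr.
by rewrite invr_ge0 mulr_ge0 ?ltW// exprn_gt0// ltr_wpDr.
Qed.

Lemma sin_piMn (R : realType) (k : nat) : sin (pi *+ k) = 0 :> R.
Proof. by elim: k => [|k IH]; rewrite ?sin0// mulrSr sinDpi IH oppr0. Qed.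

(** * Moduli, limits and series in the complex plane *)

HB.instance Definition _ (R : realType) :=
  GRing.RMorphism.copy (@ofR R) (real_complex R).

Lemma ler_ofR (R : realType) (x y : R) : (ofR x <= ofR y) = (x <= y).
Proof. exact: lecR. Qed.

Lemma norm_ofR (R : realType) (x : R) : `|ofR x| = ofR `|x|.
Proof. by rewrite normc_def/= expr0n/= addr0 sqrtr_sqr. Qed.

Lemma ofR_eq0 (R : realType) (x : R) : (ofR x == 0) = (x == 0).
Proof. exact: fmorph_eq0. Qed.

(** The norm of [Cplx R] takes its values in [Cplx R]; this is the same number as an element of [R],
    where real analysis applies. *)
Definition modulus (R : realType) (z : Cplx R) : R := complex.Re `|z|.

Lemma modulusE (R : realType) (z : Cplx R) : `|z| = ofR (modulus R z).
Proof. by rewrite /modulus normc_def. Qed.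

Lemma modulus_ge0 (R : realType) (z : Cplx R) : 0 <= modulus R z.
Proof. by rewrite -ler_ofR rmorph0 -modulusE. Qed.

Lemma cvg_modulus (R : realType) (f : nat -> Cplx R) (l : Cplx R) (g : nat -> R) :
  (forall n, `|l - f n| <= ofR (g n)) -> g @ \oo --> (0 : R) -> f @ \oo --> l.
Proof.
move=> fg g0; apply/cvgrPdist_le => e.
(* A positive [e] in [Cplx R] has zero imaginary part, so the estimate becomes one between reals. *)
case: e => e e'; rewrite ltcE/= => /andP[/eqP e'0 e0]; rewrite e'0.
near=> n; apply: le_trans (fg n) _; rewrite -[X in _ <= X]/(ofR e) ler_ofR.
apply: le_trans (ler_norm _) _; near: n.
by move/cvgr0Pnorm_le : g0; apply.
Unshelve. all: by end_near. Qed.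

(** The modulus dominates the real and imaginary parts, whose series therefore converge absolutely
    in [R]. *)
Lemma cvg_series_modulus (R : realType) (u : nat -> Cplx R) :
  cvgn (series (fun n => modulus R (u n))) -> cvgn (series u).
Proof.
move=> cu.
have cvg_comp (h : nat -> R) : (forall n, `|h n| <= modulus R (u n)) ->
    cvgn (series h).
  move=> hu; apply: normed_cvg.
  by apply: (series_le_cvg _ _ _ cu) => n /=; [exact: normr_ge0|exact: modulus_ge0|exact: hu].
have /cvg_comp cr i : `|complex.Re (u i)| <= modulus R (u i).
  by rewrite -ler_ofR -modulusE normc_ge_Re.
have /cvg_comp ci i : `|complex.Im (u i)| <= modulus R (u i).
  rewrite -ler_ofR -modulusE -normrN -ReiNIm (le_trans (normc_ge_Re _))//.
  by rewrite normrM complexiE normCi mulr1.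
set a := limn _ in cr; set b := limn _ in ci.
apply/cvg_ex; exists (ofR a + 'i * ofR b).
apply: (@cvg_modulus _ _ _ (fun n => `|a - series (fun n => complex.Re (u n)) n|
  + `|b - series (fun n => complex.Im (u n)) n|)).
  move=> n.
  have -> : series u n = ofR (series (fun n => complex.Re (u n)) n)
      + 'i * ofR (series (fun n => complex.Im (u n)) n).
    rewrite /series/= !rmorph_sum/= mulr_sumr -big_split/=.
    by apply: eq_bigr => i _; rewrite -complexiE; exact: complexE.
  rewrite opprD addrACA -rmorphB -mulrBr -rmorphB (le_trans (ler_normD _ _))//.
  by rewrite normrM normCi mul1r !norm_ofR -rmorphD.
have dist0 (h : nat -> R) (l : R) :
    h @ \oo --> l -> (fun n => `|l - h n|) @ \oo --> (0 : R).
  move=> hl; rewrite -(normr0 R) -(subrr l); apply: cvg_norm.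
  by apply: cvgB => //; exact: cvg_cst.
by rewrite -(addr0 0); apply: cvgD; exact: dist0.
Qed.

(** * Roots and factorisation of the approximating polynomials *)

Lemma de_Moivre (R : realType) (x : R) (n : nat) :
  (ofR (cos x) + 'i * ofR (sin x)) ^+ n
  = ofR (cos (x *+ n)) + 'i * ofR (sin (x *+ n)) :> Cplx R.
Proof.
elim: n => [|n IH]; first by rewrite expr0 mulr0n cos0 sin0 rmorph1 rmorph0 mulr0 addr0.
rewrite exprSr IH mulrSr cosD sinD rmorphB rmorphD !rmorphM/=.
set c := ofR _; set s := ofR _; set c' := ofR _; set s' := ofR _.
have -> : (c + 'i * s) * (c' + 'i * s') =
  c * c' + 'i ^+ 2 * (s * s') + 'i * (s * c' + c * s') by ring.
by rewrite sqrCi mulN1r.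
Qed.

Definition sinch_poly (K : fieldType) (N : nat) : {poly K} :=
  \poly_(m < N.+1) ('C(N.*2.+1, m.*2.+1)%:R / N.*2.+1%:R ^+ m.*2.+1).

Definition sinch_node (R : realType) (N k : nat) : R :=
  pi *+ k / N.*2.+1%:R.

Lemma sinch_node_itv (R : realType) (N k : nat) : (0 < k <= N)%N ->
  0 < sinch_node R N k < pi / 2.
Proof.
move=> /andP[k0 kN]; rewrite /sinch_node -(mulr_natl pi k).
have p0 := pi_gt0 R; have n0 : 0 < N.*2.+1%:R :> R by rewrite ltr0n.
rewrite divr_gt0 ?mulr_gt0 ?ltr0n//= ltr_pdivrMr// mulrAC ltr_pdivlMr//.
by rewrite -mulrA mulrC -mulrA ltr_pM2l// -natrM ltr_nat; lia.
Qed.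

Lemma sinch_poly_root (R : realType) (N k : nat) : (0 < k <= N)%N ->
  root (sinch_poly (Cplx R) N)
    (- ofR ((N.*2.+1%:R * tan (sinch_node R N k)) ^+ 2)).
Proof.
move=> kN; set t := sinch_node R N k; have /andP[t0 tp] := sinch_node_itv R N k kN.
have c0 : 0 < cos t by rewrite cos_gt0_pihalf// tp (lt_trans _ t0)// oppr_lt0 divr_gt0 ?pi_gt0.
have s0 : 0 < sin t by rewrite sin_gt0_pihalf ?t0.
have n0 : N.*2.+1%:R != 0 :> Cplx R by rewrite pnatr_eq0.
pose x : Cplx R := 'i * ofR (tan t).
have x0 : x != 0.
  by rewrite mulf_neq0 ?neq0Ci// ofR_eq0 mulf_neq0 ?invr_eq0 ?gt_eqF.
have tn : t *+ N.*2.+1 = pi *+ k.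
  by rewrite -mulr_natr divfK// pnatr_eq0.
have DM := de_Moivre R t N.*2.+1; have DMN := de_Moivre R (- t) N.*2.+1.
have c0' : ofR (cos t) != 0 by rewrite ofR_eq0 gt_eqF.
(* Multiplied by [cos t ^+ n], [n = 2N + 1], the two sides become [cos (n t) + i sin (n t)] and
   [cos (n t) - i sin (n t)], and [sin (n t) = sin (k pi) = 0]. *)
have key : (1 + x) ^+ N.*2.+1 = (1 - x) ^+ N.*2.+1.
  apply: (mulfI (expf_neq0 N.*2.+1 c0')).
  rewrite -!exprMn mulrBr mulrDr mulr1.
  have -> : ofR (cos t) * x = 'i * ofR (sin t).
    by rewrite mulrCA -rmorphM/= /tan mulrCA divff ?gt_eqF// mulr1.
  rewrite -mulrN -rmorphN/= -sinN -{2}(cosN t) DM DMN.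
  by rewrite mulNrn cosN sinN tn sin_piMn oppr0.
have := odd_part_binomial (Cplx R) x N.
rewrite key subrr => /esym/eqP.
rewrite mulrn_eq0/= mulf_eq0 (negbTE x0)/= => /eqP sum0.
rewrite /root /sinch_poly horner_poly.
(* At [(n x)^2 = - (n tan t)^2] the polynomial is [1/n] times the sum that vanishes by [sum0]. *)
apply/eqP; rewrite -[RHS](mulr0 N.*2.+1%:R^-1) -[X in _ = _ * X]sum0 mulr_sumr.
apply: eq_bigr => m _; rewrite [RHS]mulrCA -[LHS]mulrA; congr (_ * _).
have -> : - ofR ((N.*2.+1%:R * tan t) ^+ 2) = N.*2.+1%:R ^+ 2 * x ^+ 2.
  rewrite /x -exprMn [X in _ = X ^+ 2]mulrCA [RHS]exprMn sqrCi mulN1r.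
  by rewrite -(rmorph_nat (@ofR R)) -rmorphM -rmorphXn.
by rewrite exprMn -!exprM !mul2n [N.*2.+1%:R ^+ _.+1]exprS invfM -mulrA mulKf//.
Qed.

Lemma sinch_poly_prod (R : realType) (N : nat) (y : Cplx R) :
  (sinch_poly (Cplx R) N).[y] =
  \prod_(1 <= k < N.+1)
    (1 + y / ofR ((N.*2.+1%:R * tan (sinch_node R N k)) ^+ 2)).
Proof.
pose r k : Cplx R := - ofR ((N.*2.+1%:R * tan (sinch_node R N k)) ^+ 2).
have n0 : N.*2.+1%:R != 0 :> Cplx R by rewrite pnatr_eq0.
rewrite (poly_prod_roots _ _ [seq r k | k <- index_iota 1 N.+1]).
- by rewrite big_map; apply: eq_bigr => k _; rewrite /r invrN mulrN opprK.
- rewrite size_map size_iota subn1/= /sinch_poly size_poly_eq//.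
  by rewrite binn mul1r invr_eq0 expf_neq0.
- by rewrite horner_coef0 coef_poly/= bin1 expr1 divff.
- by apply/allP => _ /mapP[k + ->]; rewrite mem_index_iota ltnS => /(sinch_poly_root R).
(* The roots are distinct because [tan] is positive and injective on the nodes; hence these [N]
   roots exhaust the degree. *)
rewrite map_inj_in_uniq ?iota_uniq// => i j.
rewrite !mem_index_iota !ltnS => /(sinch_node_itv R) iN /(sinch_node_itv R) jN.
have tan0 x : 0 < x < pi / 2 -> 0 < tan x :> R.
  by move=> /andP[x0 xp]; apply: (lt_le_trans x0); apply: tan_ge; rewrite ltW.
have := tan0 _ iN; have := tan0 _ jN.
move=> tj ti /oppr_inj/fmorph_inj.
have N0 : 0 < N.*2.+1%:R :> R by rewrite ltr0n.
move=> /eqP; rewrite eqrXn2//; [|exact: ltW (mulr_gt0 N0 _)..] => /eqP/(mulfI (lt0r_neq0 N0)).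
have [/andP[i0 ip] /andP[j0 jp]] := (iN, jN).
move=> /tan_inj; rewrite !in_itv/= ip jp !andbT.
have np : - (pi / 2) < 0 :> R by rewrite oppr_lt0 divr_gt0 ?pi_gt0.
rewrite !(lt_trans np)// => /(_ isT isT); rewrite /sinch_node => /divIf.
rewrite -!(mulr_natl pi) => /(_ (lt0r_neq0 N0)).
by move=> /(mulIf (lt0r_neq0 (pi_gt0 R)))/eqP; rewrite eqr_nat => /eqP.
Qed.

(** * Comparison of the polynomials with the power series *)

(** With [j = 2m + 1] the difference is [(n^j - n^_j) / (j! n^j)], at most
    ['C(j, 2) / (j! n) = m / ((2m)! n)]. The remaining [1/m!] makes the bounds summable against
    powers of [|z|^2]. *)
Lemma sinch_poly_coef_dist (K : numFieldType) (N m : nat) :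
  `|'C(N.*2.+1, m.*2.+1)%:R / N.*2.+1%:R ^+ m.*2.+1 - (m.*2.+1)`!%:R^-1|
    <= N.*2.+1%:R^-1 / m`!%:R :> K.
Proof.
set n := N.*2.+1; set j := m.*2.+1.
have n0 : 0 < n%:R :> K by rewrite ltr0n.
have j0 : 0 < j`!%:R :> K by rewrite ltr0n fact_gt0.
have m0 : 0 < m`!%:R :> K by rewrite ltr0n fact_gt0.
have nj : (n ^_ j <= n ^ j)%N.
  by elim: (j) => // i IH; rewrite ffactnSr expnS mulnC leq_mul// leq_subr.
rewrite distrC.
have -> : j`!%:R^-1 - 'C(n, j)%:R / n%:R ^+ j =
    (n ^ j - n ^_ j)%N%:R / (j`!%:R * n%:R ^+ j) :> K.
  rewrite natrB// -bin_ffact natrM natrX; field.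
  by rewrite expf_neq0 (lt0r_neq0 n0, lt0r_neq0 j0).
rewrite normrM ger0_norm ?ler0n// ger0_norm; last first.
  by rewrite invr_ge0 mulr_ge0 ?exprn_ge0 ?ltW.
rewrite ler_pdivrMr ?mulr_gt0 ?exprn_gt0// -invfM mulrC ler_pdivlMr ?mulr_gt0//.
rewrite -natrX -!natrM ler_nat.
have h := expn_le_ffact n j.
have := fact_dbl_ge m.
have bj : 'C(j, 2) = (m * j)%N by rewrite bin2 /j/= -doubleMr mulnC doubleK.
rewrite {}bj in h; have jE : j`! = (j * (m.*2)`!)%N by rewrite /j factS.
rewrite jE => hm.
apply: (@leq_trans (m * j * n ^ j * m`!)%N); last first.
  have -> : (m * j * n ^ j * m`! = j * n ^ j * (m * m`!))%N by ring.
  have -> : (j * (m.*2)`! * n ^ j = j * n ^ j * (m.*2)`!)%N by ring.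
  by rewrite leq_mul2l hm orbT.
rewrite mulnA leq_mul2r mulnBl -expnSr leq_subLR (mulnC (n ^_ j)) h orbT //.
Qed.

Lemma modulus_series_term (R : realType) (z : Cplx R) (m : nat) :
  modulus R (z ^+ (2 * m) / ((2 * m).+1)`!%:R) =
  (modulus R z ^+ 2) ^+ m / (m.*2.+1)`!%:R.
Proof.
apply: (fmorph_inj (@ofR R)); rewrite -[LHS]modulusE normrM normrX normfV normr_nat.
by rewrite modulusE fmorph_div rmorph_nat !rmorphXn exprM mul2n.
Qed.

(** The exponential series at [|z|^2] dominates, since [m! <= (2m+1)!]. *)
Lemma cvg_sinch (R : realType) (z : Cplx R) :
  series (fun m : nat => z ^+ (2 * m) / ((2 * m).+1)`!%:R) @ \oo --> sinch z.
Proof.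
apply: cvg_series_modulus.
apply: (series_le_cvg _ _ _ (is_cvg_series_exp_coeff (modulus R z ^+ 2))) => m.
- exact: modulus_ge0.
- by rewrite exp_coeff_ge0// sqr_ge0.
rewrite modulus_series_term /exp_coeff/= ler_wpM2l ?exprn_ge0 ?modulus_ge0//.
rewrite lef_pV2 ?posrE ?ltr0n ?fact_gt0// ler_nat.
by apply: leq_fact; lia.
Qed.

Lemma partial_exp_le_expR (R : realType) (x : R) (n : nat) : 0 <= x ->
  \sum_(m < n) x ^+ m / m`!%:R <= expR x.
Proof.
move=> x0; rewrite /expR.
have -> : \sum_(m < n) x ^+ m / m`!%:R = series (exp_coeff x) n.
  by rewrite /series/= big_mkord.
apply: nondecreasing_cvgn_le; last exact: is_cvg_series_exp_coeff.
by apply: nondecreasing_series => i _ _; exact: exp_coeff_ge0.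
Qed.

(** The polynomial has [N + 1] coefficients, as many as the partial sum has terms, so the difference
    is taken term by term and summed into an exponential. *)
Lemma sinch_poly_series_dist (R : realType) (z : Cplx R) (N : nat) :
  `|(sinch_poly (Cplx R) N).[z ^+ 2]
     - series (fun m : nat => z ^+ (2 * m) / ((2 * m).+1)`!%:R) N.+1|
    <= ofR (expR (modulus R z ^+ 2) / N.*2.+1%:R).
Proof.
rewrite /sinch_poly horner_poly /series/= big_mkord -sumrB.
apply: le_trans (ler_norm_sum _ _ _) _.
apply: (@le_trans _ _ (ofR (\sum_(m < N.+1)
    (modulus R z ^+ 2) ^+ m / m`!%:R / N.*2.+1%:R))); last first.
  rewrite ler_ofR -mulr_suml ler_wpM2r ?invr_ge0//.
  by apply: partial_exp_le_expR; exact: sqr_ge0.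
rewrite rmorph_sum; apply: ler_sum => m _.
rewrite exprM mul2n [X in _ - X]mulrC -mulrBl normrM !normrX.
apply: le_trans (ler_wpM2r _ (sinch_poly_coef_dist _ _ _)) _.
  by rewrite !exprn_ge0.
rewrite modulusE !fmorph_div !rmorph_nat 2!rmorphXn.
by rewrite mulrC (mulrC N.*2.+1%:R^-1) mulrA; exact: lexx.
Qed.

(** * The Euler product *)

(** The term [k = 1] contributes 1 and the telescoping tail at most 1, before division by [pi ^+ 2];
    the bound is uniform in [N]. *)
Lemma sum_inv_pi_sqr_le (R : realType) (N : nat) :
  \sum_(1 <= k < N.+1) ((k%:R * pi : R) ^+ 2)^-1 <= 2 / pi ^+ 2.
Proof.
under eq_bigr do rewrite exprMn invfM.
rewrite -mulr_suml ler_wpM2r ?invr_ge0 ?sqr_ge0//.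
case: N => [|N]; first by rewrite big_geq.
rewrite big_nat_recl//= expr1n invr1 -lerBrDl.
rewrite -(big_add1 _ _ 1 N.+2 xpredT (fun k => (k%:R ^+ 2)^-1)).
rewrite (le_trans (sum_inv_sqr_le R 1 N.+1 isT isT))// invr1.
have := invr_ge0 (N.+1%:R : R); rewrite ler0n; set x := _^-1; lra.
Qed.

Lemma sinch_poly_euler_dist (R : realType) (z : Cplx R) (N : nat) :
  `|(sinch_poly (Cplx R) N).[z ^+ 2]
     - \prod_(1 <= k < N.+1) (1 + z ^+ 2 / ofR ((k%:R * pi) ^+ 2))|
    <= ofR (expR (modulus R z ^+ 2 * (2 / pi ^+ 2)) * modulus R z ^+ 2
            / N.*2.+1%:R).
Proof.
rewrite sinch_poly_prod; set n := N.*2.+1.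
have n0 : 0 < n%:R :> R by rewrite ltr0n.
set q := modulus R z ^+ 2; have q0 : 0 <= q by exact: sqr_ge0.
have zq : `|z ^+ 2| = ofR q by rewrite normrX modulusE -rmorphXn.
(* This is [inv_tan_sqr] at [x = k pi / n], divided by [n^2]. *)
have compare k : k \in index_iota 1 N.+1 ->
    0 <= ((k%:R * pi : R) ^+ 2)^-1 - ((n%:R * tan (sinch_node R N k)) ^+ 2)^-1
      <= (n%:R ^+ 2)^-1.
  rewrite mem_index_iota ltnS => /(sinch_node_itv R)/inv_tan_sqr.
  have -> : k%:R * pi = n%:R * sinch_node R N k :> R.
    by rewrite /sinch_node [RHS]mulrC divfK ?gt_eqF// mulr_natl.
  rewrite !exprMn !invfM -mulrBr => /andP[d0 d1].
  by rewrite mulr_ge0 ?invr_ge0 ?sqr_ge0//= ler_piMr ?invr_ge0 ?sqr_ge0.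
have normq (x : R) : 0 <= x -> `|z ^+ 2 / ofR x| = ofR (q / x).
  by move=> x0; rewrite normrM normfV zq norm_ofR (ger0_norm x0) -fmorph_div.
(* The majorant [q / (k pi)^2] serves both products because [k pi <= n tan (k pi / n)]. *)
apply: le_trans (dist_prod1D _ _ _ _ _
  (fun k => ofR (q / (k%:R * pi) ^+ 2)) _ _) _.
- move=> k kN; rewrite normq ?sqr_ge0// ler_ofR ler_wpM2l//.
  by rewrite -subr_ge0; have /andP[] := compare k kN.
- by move=> k kN; rewrite normq ?sqr_ge0.
rewrite -mulrA rmorphM; apply: ler_pM.
- apply: prodr_ge0 => k _; rewrite addr_ge0//.
  by rewrite -(rmorph0 (@ofR R)) ler_ofR divr_ge0 ?sqr_ge0.
- exact: sumr_ge0.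
- have -> : \prod_(1 <= k < N.+1) (1 + ofR (q / (k%:R * pi) ^+ 2))
     = ofR (\prod_(1 <= k < N.+1) (1 + q / (k%:R * pi) ^+ 2)).
    by rewrite rmorph_prod; apply: eq_bigr => k _; rewrite rmorphD rmorph1.
  rewrite ler_ofR (le_trans (prod1D_le_expR _ _ _ _ _))//.
    by move=> k; rewrite divr_ge0 ?sqr_ge0.
  by rewrite ler_expR -mulr_sumr ler_wpM2l// sum_inv_pi_sqr_le.
apply: (@le_trans _ _ (ofR (\sum_(1 <= k < N.+1) q / n%:R ^+ 2))).
  rewrite rmorph_sum big_seq [leRHS]big_seq; apply: ler_sum => k kN.
  rewrite -mulrBr -!fmorphV -rmorphB normrM zq norm_ofR -rmorphM ler_ofR.
  have /andP[d0 d1] := compare k kN.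
  by rewrite ler_wpM2l// distrC ger0_norm.
(* There are [N <= n] terms [q / n^2], hence at most [q / n]. *)
rewrite ler_ofR sumr_const_nat subn1/= -[leLHS]mulr_natr -mulrA ler_wpM2l//.
rewrite expr2 invfM -mulrA ler_piMr ?invr_ge0 ?ler0n//.
by rewrite mulrC ler_pdivrMr// mul1r ler_nat; lia.
Qed.

Lemma sinch_euler_product (R : realType) (z : Cplx R) :
  (fun N : nat => \prod_(1 <= k < N.+1) (1 + z ^+ 2 / ofR ((k%:R * pi) ^+ 2)))
    @ \oo --> sinch z.
Proof.
set B := (fun N : nat => _).
pose S := series (fun m : nat => z ^+ (2 * m) / ((2 * m).+1)`!%:R).
have S1 : (fun N => S N.+1) @ \oo --> sinch z.
  by have := cvg_sinch R z; rewrite -cvg_shiftS.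
pose c := expR (modulus R z ^+ 2 * (2 / pi ^+ 2)) * modulus R z ^+ 2
  + expR (modulus R z ^+ 2).
have c0 : 0 <= c.
  by rewrite addr_ge0 ?mulr_ge0 ?modulus_ge0 ?expR_ge0.
(* Both products and partial sums lie within [O(1/n)] of the polynomial value, and
   [n = 2N + 1 >= N + 1] brings in [harmonic]. *)
have BS : (fun N => B N - S N.+1) @ \oo --> (0 : Cplx R).
  apply: (@cvg_modulus _ _ _ (fun N => c * harmonic N)) => [N|].
    rewrite sub0r normrN.
    rewrite -(subrKA (sinch_poly (Cplx R) N).[z ^+ 2]).
    rewrite (le_trans (ler_normD _ _))// distrC.
    have := lerD (sinch_poly_euler_dist R z N) (sinch_poly_series_dist R z N).
    move=> /le_trans; apply; rewrite -rmorphD -mulrDl ler_ofR ler_wpM2l//.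
    by rewrite lef_pV2 ?posrE ?ltr0n// ler_nat; lia.
  by rewrite -(mulr0 c); apply: cvgM; [exact: cvg_cst|exact: cvg_harmonic].
have BE : B = (fun N => B N - S N.+1 + S N.+1).
  by apply/funext => N; rewrite subrK.
rewrite BE -(add0r (sinch z)); exact: (cvgD BS S1).
Qed.

(** * Non-vanishing of sinch and the quotient of two products *)

Lemma sinch_neq0 (R : realType) (z : Cplx R) :
  (forall k : nat, (0 < k)%N -> 1 + z ^+ 2 / ofR ((k%:R * pi) ^+ 2) != 0) ->
  sinch z != 0.
Proof.
move=> fn0; set q := modulus R z ^+ 2.
have q0 : 0 <= q by exact: sqr_ge0.
pose K := (Num.trunc (2 * q)).+1.
have qK : 2 * q < K%:R by rewrite /K truncnS_gt.
pose A (m n : nat) := \prod_(m.+1 <= k < n.+1) (1 + z ^+ 2 / ofR ((k%:R * pi) ^+ 2)).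
(* [\sum_(k > K) q / (k pi)^2 <= q / K < 1/2] *)
have tail n : (K <= n)%N -> 2^-1 <= `|A K n|.
  move=> Kn; have : \sum_(K.+1 <= k < n.+1) `|z ^+ 2 / ofR ((k%:R * pi) ^+ 2)|
      <= ofR 2^-1.
    apply: (@le_trans _ _ (ofR (\sum_(K.+1 <= k < n.+1) q / k%:R ^+ 2))).
      rewrite rmorph_sum; apply: ler_sum => k _.
      rewrite normrM normrX normfV norm_ofR modulusE -rmorphXn.
      rewrite -fmorphV -rmorphM ler_ofR ler_wpM2l//.
      (* The range of [k] has been dropped here; at [k = 0] both sides are the inverse of 0, which
         is 0. *)
      have [->|k0] := eqVneq k 0%N; first by rewrite mul0r expr0n/= normr0.
      have kp : 0 < k%:R :> R by rewrite ltr0n lt0n.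
      rewrite ger0_norm ?sqr_ge0// lef_pV2 ?posrE ?exprn_gt0 ?mulr_gt0 ?pi_gt0//.
      rewrite exprMn ler_peMr ?sqr_ge0// expr_ge1 ?pi_ge0//.
      by rewrite (le_trans _ (pi_ge2 R))// ler1n.
    rewrite ler_ofR -mulr_sumr.
    rewrite (le_trans (ler_wpM2l q0 (sum_inv_sqr_le R K n isT Kn)))//.
    rewrite (@le_trans _ _ (q * K%:R^-1))//.
      by rewrite ler_wpM2l// gerBl invr_ge0.
    by rewrite ler_pdivrMr ?ltr0n// mulrC ler_pdivlMr// mulrC ltW.
  rewrite fmorphV rmorph_nat => le2.
  apply: le_trans (prod1D_ge _ _ _ _ _); last first.
    by rewrite (le_trans le2)// invf_le1// ler1n.
  have half : 2^-1 + 2^-1 = 1 :> Cplx R by field.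
  by rewrite lerBrDr -[leRHS]half lerD2l.
(* A zero limit would bring the partial products below half of the nonzero head [A 0 K], while the
   tail factor has modulus at least 1/2. *)
apply/eqP => s0; have A0 : `|A 0%N K| / 2 > 0.
  rewrite divr_gt0// normr_gt0 prodf_seq_neq0; apply/allP => k.
  by rewrite mem_index_iota => /andP[k0 _]; exact: fn0.
have := sinch_euler_product R z; rewrite s0 => /cvgr0Pnorm_lt /(_ _ A0) [N _ AN].
(* The index must pass [N] for smallness and [K] for the product to split there. *)
have /= := AN (maxn N K) (leq_maxl _ _).
rewrite (big_cat_nat (n := K.+1))//= ?ltnS ?leq_maxr// normrM.
move=> /(le_lt_trans (ler_wpM2l (normr_ge0 _) (tail _ (leq_maxr N K)))).
by rewrite ltxx.
Qed.

(* The source prints the prefactor as sinch(beta); it is corrected here to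
   sinch(beta - l), since the printed identity is false (s = beta = l = 1). *)
Theorem corollary8 (R : realType) (s : Cplx R) (l : R) (hl : l != 0)
    (beta : Cplx R)
    (hbeta : forall k : int, k != 0 ->
       beta != ofR l + 'i * k%:~R * ofR pi) :
  exists P : Cplx R,
    is_infprod (fun k : nat =>
        1 + ((s - ofR l) ^+ 2 - (beta - ofR l) ^+ 2)
            / (k%:R ^+ 2 * ofR pi ^+ 2 + (beta - ofR l) ^+ 2)) P
    /\ sinch (s - ofR l) = sinch (beta - ofR l) * P.
Proof.
set z := s - ofR l; set w := beta - ofR l.
(* The sum factors as [(w - i k pi) (w + i k pi)]; [hbeta] at [k] and at [-k] excludes the two
   zeros. *)
have wn0 (k : nat) : (0 < k)%N -> k%:R ^+ 2 * ofR pi ^+ 2 + w ^+ 2 != 0.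
  move=> k0.
  have -> : k%:R ^+ 2 * ofR pi ^+ 2 + w ^+ 2 =
      (w - 'i * (k%:R * ofR pi)) * (w + 'i * (k%:R * ofR pi)).
    by rewrite -subr_sqr exprMn sqrCi mulN1r opprK exprMn addrC.
  rewrite mulf_neq0//.
    have := hbeta k%:Z; rewrite eqz_nat -lt0n => /(_ k0); apply: contra.
    by rewrite /w subr_eq0 subr_eq addrC mulrA.
  have := hbeta (- k%:Z); rewrite oppr_eq0 eqz_nat -lt0n => /(_ k0); apply: contra.
  by rewrite /w addr_eq0 subr_eq addrC mulrA mulrNz mulrN mulNr.
have kp0 (k : nat) : (0 < k)%N -> k%:R ^+ 2 * ofR pi ^+ 2 != 0 :> Cplx R.
  by move=> k0; rewrite mulf_neq0 ?expf_neq0 ?pnatr_eq0 -?lt0n// ofR_eq0 gt_eqF ?pi_gt0.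
have ofRE (k : nat) : ofR ((k%:R * pi) ^+ 2) = k%:R ^+ 2 * ofR pi ^+ 2 :> Cplx R.
  by rewrite rmorphXn rmorphM rmorph_nat exprMn.
have sw0 : sinch w != 0.
  apply: sinch_neq0 => k k0; rewrite ofRE.
  apply: contra (wn0 k k0) => /eqP h.
  by rewrite -[w ^+ 2](divfK (kp0 k k0)) -{1}[_ * _]mul1r -mulrDl h mul0r.
exists (sinch z / sinch w); split; last by rewrite mulrC divfK.
rewrite /is_infprod.
(* With [a = k^2 pi^2], each factor is [(1 + z^2/a) / (1 + w^2/a)]. *)
have -> : (fun n : nat => \prod_(1 <= k < n.+1) (1 + (z ^+ 2 - w ^+ 2)
      / (k%:R ^+ 2 * ofR pi ^+ 2 + w ^+ 2))) =
   (fun n : nat => \prod_(1 <= k < n.+1) (1 + z ^+ 2 / ofR ((k%:R * pi) ^+ 2))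
     / \prod_(1 <= k < n.+1) (1 + w ^+ 2 / ofR ((k%:R * pi) ^+ 2))).
  apply/funext => n; rewrite -prodf_div big_seq [RHS]big_seq.
  apply: eq_bigr => k; rewrite mem_index_iota => /andP[k0 _]; rewrite ofRE.
  move: (wn0 k k0) (kp0 k k0); set a := k%:R ^+ 2 * _ => aw a0.
  by field; rewrite aw a0.
by apply: cvgM; [|apply: cvgV => //]; exact: sinch_euler_product.
Qed.
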